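(* Let $\mathrm{Sp}(v)$ be an indecomposable admissible component. Then $$\mathbb C\pi_S\cap\Delta_{\mathrm{iso}}\neq\emptyset\ \Longrightarrow\ \mathbb C\Delta=\mathbb C\pi_S,$$ where $\mathbb CS$ denotes the complex span of $S$.
   Context: All vector spaces are over $\mathbb C$. Fix a finite set $X$. A root datum is $v=(\mathfrak h,a,b,p)$ with $\mathfrak h$ a finite-dimensional vector space, $a:X\to\mathfrak h$ and $b:X\to\mathfrak h^*$ maps whose values form linearly independent families, and $p:X\to\mathbb Z_2$. Write $a_v,b_v,p_v$ for these maps. The Cartan matrix is $A^v=(a^v_{xy})$, $a^v_{xy}=\langle a_v(x),b_v(y)\rangle$. An element $x\in X$ is reflectable at $v$ if either $a_{xx}=0$, $p(x)=\bar1$; or $a_{xx}\ne0$, $p(x)=\bar0$ and $2a_{xy}/a_{xx}\in\mathbb Z_{\le0}$ for all $y\ne x$; or $a_{xx}\ne0$, $p(x)=\bar1$ and $a_{xy}/a_{xx}\in\mathbb Z_{\le0}$ for all $y\ne x$. For such $x$ the reflexion $r_x:v\to v'=(\mathfrak h,a',b',p')$ is: if $a_{xx}\neq0$ (anisotropic reflexion), $p'=p$, $a'(y)=a(y)-2\frac{a_{yx}}{a_{xx}}a(x)$, $b'(y)=b(y)-2\frac{a_{xy}}{a_{xx}}b(x)$; if $a_{xx}=0$ (isotropic reflexion), $(a',b',p')(x)=(-a(x),-b(x),p(x))$, and for $y\ne x$: $(a',b',p')(y)=(a(y),b(y),p(y))$ if $a_{xy}=0$, $(a',b',p')(y)=(a(y)+\frac{a_{yx}}{a_{xy}}a(x),\,b(y)+b(x),\,p(y)+\bar1)$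 if $a_{xy}\ne0$. The skeleton $\mathrm{Sk}(v)$ (resp. the spine $\mathrm{Sp}(v)$) is the set of root data obtained from $v$ by finite sequences of reflexions (resp. isotropic reflexions). The component is admissible if $a^u_{xy}=0\Rightarrow a^u_{yx}=0$ for all $u\in\mathrm{Sk}(v)$, all $x$ reflectable at $u$ and all $y\in X$. It is indecomposable if for every $u\in\mathrm{Sk}(v)$ (equivalently, every $u\in\mathrm{Sp}(v)$) either $A^u=(0)$ is the $1\times1$ zero matrix or the directed graph on $X$ with an edge $x\to y$ whenever $a^u_{xy}\ne0$ is strongly connected. The contragredient Lie superalgebra $\mathfrak g$ is generated by the commutative even algebra $\mathfrak h$ and elements $e_{\pm b_v(x)}$ of parity $p_v(x)$, $x\in X$, with relations $[e_{b(x)},e_{-b(y)}]=\delta_{xy}a(x)$, $[h,e_{\pm b(x)}]=\pm\langle h,b(x)\rangle e_{\pm b(x)}$, modulo the maximal ideal intersecting $\mathfrak h$ trivially; replacing $v$ by $u\in\mathrm{Sk}(v)$ gives an isomorphic algebra with the same root system. $\Delta\subset\mathfrak h^*$ is the set of nonzero weights of $\mathfrak h$ in $\mathfrak g$. $\Delta_{\mathrm{iso}}$ is the set of isotropic roots: all $b_u(x)$ with $u\in\mathrm{Sk}(v)$, $x$ reflectable at $u$ and $a^u_{xx}=0$. An element $\alpha\in\mathfrak h^*$ is $S$-principal if for some $u\in\mathrm{Sp}(v)$ and $x\in X$ either $\alpha=b_u(x)$ and $p_u(x)=\bar0$, or $\alpha=2b_u(x)$, $p_u(x)=\bar1$ and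 $a^u_{xx}\ne0$; $\pi_S$ is the set of $S$-principal elements. *)

(* Defs.v *)
From mathcomp Require Import all_boot all_order all_algebra.
From mathcomp Require Import classical_sets.

Set Implicit Arguments.
Unset Strict Implicit.
Unset Printing Implicit Defensive.

Import GRing.Theory.
Local Open Scope ring_scope.
Local Open Scope classical_set_scope.

Section RootData.
Variables (K : fieldType) (X : finType) (V : vectType K).

(* Parities in Z_2 are booleans: [true] is the odd class and [(+)] the sum. *)
Record datum := Datum {
  ra : X -> V;
  rb : X -> 'Hom(V, K^o);
  rp : X -> bool
}.

(* Reflexions preserve linear independence, so it is enough to impose it on
   the datum one starts from. *)
Definition root_datum (v : datum) : Prop :=
  free [seq ra v x | x <- enum X] /\ free [seq rb v x | x <- enum X].

Definition cartan (v : datum) (x y : X) : K := rb v y (ra v x).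

Definition nonpos_int (c : K) : Prop := exists n : nat, c = - n%:R.

Definition isotropic_at (v : datum) (x : X) : Prop :=
  cartan v x x = 0 /\ rp v x = true.

Definition reflectable (v : datum) (x : X) : Prop :=
  [\/ isotropic_at v x,
      [/\ cartan v x x != 0, rp v x = false &
          forall y, y != x -> nonpos_int (2%:R * cartan v x y / cartan v x x)]
    | [/\ cartan v x x != 0, rp v x = true &
          forall y, y != x -> nonpos_int (cartan v x y / cartan v x x)]].

Definition aniso_reflexion (v : datum) (x : X) : datum :=
  Datum
    (fun y => ra v y - (2%:R * (cartan v y x / cartan v x x)) *: ra v x)
    (fun y => rb v y - (2%:R * (cartan v x y / cartan v x x)) *: rb v x)
    (rp v).

Definition iso_reflexion (v : datum) (x : X) : datum :=
  Datum
    (fun y => if y == x then - ra v x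
              else if cartan v x y == 0 then ra v y
              else ra v y + (cartan v y x / cartan v x y) *: ra v x)
    (fun y => if y == x then - rb v x
              else if cartan v x y == 0 then rb v y
              else rb v y + rb v x)
    (fun y => if y == x then rp v x
              else if cartan v x y == 0 then rp v y
              else rp v y (+) true).

Definition reflexion (v : datum) (x : X) : datum :=
  if cartan v x x == 0 then iso_reflexion v x else aniso_reflexion v x.

Inductive Sk (v : datum) : datum -> Prop :=
| Sk_refl : Sk v v
| Sk_step u x : Sk v u -> reflectable u x -> Sk v (reflexion u x).

Inductive Sp (v : datum) : datum -> Prop :=
| Sp_refl : Sp v v
| Sp_step u x : Sp v u -> reflectable u x -> cartan u x x = 0 ->
    Sp v (reflexion u x).

Definition admissible (v : datum) : Prop :=
  forall u x y, Sk v u -> reflectable u x ->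
    cartan u x y = 0 -> cartan u y x = 0.

Definition strongly_connected (e : rel X) : Prop := forall x y, connect e x y.

Definition indecomposable (v : datum) : Prop :=
  forall u, Sk v u ->
    (#|X| = 1%N /\ forall x y, cartan u x y = 0)
    \/ strongly_connected (fun x y => cartan u x y != 0).

Definition Delta_iso (v : datum) : set 'Hom(V, K^o) :=
  [set alpha : 'Hom(V, K^o) | exists u x,
     [/\ Sk v u, reflectable u x, cartan u x x = 0 & alpha = rb u x]].

Definition S_principal (v : datum) : set 'Hom(V, K^o) :=
  [set alpha : 'Hom(V, K^o) | exists u x, Sp v u /\
     ((alpha = rb u x /\ rp u x = false)
      \/ [/\ alpha = 2%:R *: rb u x, rp u x = true & cartan u x x != 0])].

(* Nonassociative polynomials in the elements of V and the letters
   e_{b(x)} = [TE x], e_{-b(x)} = [TF x]. *)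
Inductive term :=
| T0
| TAdd (s t : term)
| TScale (c : K) (t : term)
| TBr (s t : term)
| TH (h : V)
| TE (x : X)
| TF (x : X).

Inductive homog (v : datum) : bool -> term -> Prop :=
| homog0 i : homog v i T0
| homogD i s t : homog v i s -> homog v i t -> homog v i (TAdd s t)
| homogZ i c t : homog v i t -> homog v i (TScale c t)
| homogBr i j s t : homog v i s -> homog v j t -> homog v (i (+) j) (TBr s t)
| homogH h : homog v false (TH h)
| homogE x : homog v (rp v x) (TE x)
| homogF x : homog v (rp v x) (TF x).

(* The congruence whose quotient is the Lie superalgebra presented by the
   defining relations, before dividing by the maximal ideal.  As K is meant to
   have characteristic 0, the sign rules on homogeneous terms are all the
   axioms of a Lie superalgebra. *)
Inductive eqv (v : datum) : term -> term -> Prop :=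
| eqv_refl t : eqv v t t
| eqv_sym s t : eqv v s t -> eqv v t s
| eqv_trans s t r : eqv v s t -> eqv v t r -> eqv v s r
| eqv_D s s' t t' : eqv v s s' -> eqv v t t' -> eqv v (TAdd s t) (TAdd s' t')
| eqv_Z c t t' : eqv v t t' -> eqv v (TScale c t) (TScale c t')
| eqv_Br s s' t t' : eqv v s s' -> eqv v t t' -> eqv v (TBr s t) (TBr s' t')
| eqv_DA r s t : eqv v (TAdd r (TAdd s t)) (TAdd (TAdd r s) t)
| eqv_DC s t : eqv v (TAdd s t) (TAdd t s)
| eqv_0D t : eqv v (TAdd T0 t) t
| eqv_ND t : eqv v (TAdd (TScale (-1) t) t) T0
| eqv_ZA c d t : eqv v (TScale c (TScale d t)) (TScale (c * d) t)
| eqv_1Z t : eqv v (TScale 1 t) t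
| eqv_ZDr c s t :
    eqv v (TScale c (TAdd s t)) (TAdd (TScale c s) (TScale c t))
| eqv_ZDl c d t :
    eqv v (TScale (c + d) t) (TAdd (TScale c t) (TScale d t))
| eqv_BrDl r s t : eqv v (TBr (TAdd r s) t) (TAdd (TBr r t) (TBr s t))
| eqv_BrDr r s t : eqv v (TBr r (TAdd s t)) (TAdd (TBr r s) (TBr r t))
| eqv_BrZl c s t : eqv v (TBr (TScale c s) t) (TScale c (TBr s t))
| eqv_BrZr c s t : eqv v (TBr s (TScale c t)) (TScale c (TBr s t))
| eqv_skew i j s t : homog v i s -> homog v j t ->
    eqv v (TBr s t) (TScale (- (-1) ^+ (i && j)) (TBr t s))
| eqv_jacobi i j r s t : homog v i r -> homog v j s ->
    eqv v (TBr r (TBr s t))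
          (TAdd (TBr (TBr r s) t) (TScale ((-1) ^+ (i && j)) (TBr s (TBr r t))))
| eqv_HD h k : eqv v (TH (h + k)) (TAdd (TH h) (TH k))
| eqv_HZ c h : eqv v (TH (c *: h)) (TScale c (TH h))
| eqv_HH h k : eqv v (TBr (TH h) (TH k)) T0
| eqv_EF x y : eqv v (TBr (TE x) (TF y)) (if x == y then TH (ra v x) else T0)
| eqv_HE h x : eqv v (TBr (TH h) (TE x)) (TScale (rb v x h) (TE x))
| eqv_HF h x : eqv v (TBr (TH h) (TF x)) (TScale (- rb v x h) (TF x)).

Definition ideal (v : datum) (I : set term) : Prop :=
  [/\ I T0,
      forall s t, I s -> I t -> I (TAdd s t),
      forall c t, I t -> I (TScale c t),
      forall s t, I t -> I (TBr s t) /\ I (TBr t s) &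
      forall s t, eqv v s t -> I s -> I t].

Definition meets_V_trivially (v : datum) (I : set term) : Prop :=
  forall h, I (TH h) -> eqv v (TH h) T0.

(* For a root datum in characteristic 0, every ideal is a sum of weight spaces
   and the weight space of weight 0 is V, so the sum of the ideals meeting V
   trivially still meets V trivially: the largest such ideal exists, and it is
   the union of all of them. *)
Definition max_ideal (v : datum) : set term :=
  [set t | exists I, [/\ ideal v I, meets_V_trivially v I & I t]].

(* A weight vector of the quotient by [max_ideal] is represented by a term. *)
Definition Delta (v : datum) : set 'Hom(V, K^o) :=
  [set alpha : 'Hom(V, K^o) | alpha != 0 /\ exists t, ~ max_ideal v t /\
     forall h, max_ideal v (TAdd (TBr (TH h) t) (TScale (- alpha h) t))].

End RootData.

(* The span of [S], which may be infinite, unlike the argument of [<<_>>%VS]. *)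
Definition spanset (K : fieldType) (W : vectType K) (S : set W) : set W :=
  [set w | exists s : seq W, (forall z, z \in s -> S z) /\ w \in <<s>>%VS].

(* Main.v *)
(* Let S be the span of the S-principal elements.
   At u in Sp(v), every b_u(y) outside S is odd isotropic, so one may reflect
   at y, and each neighbour z of y with b_u(z) odd isotropic becomes even: then
   b_u(z) + b_u(y) is in S.  Anisotropic reflexions only move the b(y) inside
   their classes modulo S, so an isotropic root in S gives u in Sp(v) and x
   with b_u(x) in S odd isotropic.  If some b_u(y) were not in S, take a path
   from y to x in the graph of A^u; reflecting at y moves the vertex outside S
   along the path, without touching the rest of it if the path is shortest,
   and so ends at a neighbour of x, a contradiction.  Hence S contains all the
   b_v(x).  These span the same space as Delta: an element h of V killed by all
   of them is central in g, so weights lie in their span; conversely e_x is not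
   in the maximal ideal, since [e_x, f_x] = a(x) acts nontrivially on a Verma
   module. *)
Require Import Defs.
From mathcomp Require Import all_boot all_order all_algebra.
From mathcomp Require Import classical_sets boolp functions reals.
From mathcomp Require Import complex ring.

Import GRing.Theory.
Local Open Scope ring_scope.
Local Open Scope classical_set_scope.

Set Implicit Arguments.
Unset Strict Implicit.
Unset Printing Implicit Defensive.

(** * Spans of possibly infinite sets *)

Section SpanSet.
Variables (K : fieldType) (W : vectType K).
Implicit Types (S T : set W) (w z : W).

Lemma spanset_sub S w : S w -> spanset S w.
Proof.
move=> Sw; exists [:: w]; split; last by rewrite memv_span ?mem_head.
by move=> z; rewrite inE => /eqP ->.
Qed.

Lemma spanset0 S : spanset S 0.
Proof. by exists [::]; split=> //; rewrite mem0v. Qed.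

Lemma spansetD S w z : spanset S w -> spanset S z -> spanset S (w + z).
Proof.
move=> [s [sS sw]] [t [tS tz]]; exists (s ++ t); split.
  by move=> y; rewrite mem_cat => /orP[/sS|/tS].
by rewrite span_cat memv_add.
Qed.

Lemma spansetZ S c w : spanset S w -> spanset S (c *: w).
Proof. by move=> [s [sS sw]]; exists s; split=> //; rewrite memvZ. Qed.

Lemma spansetN S w : spanset S w -> spanset S (- w).
Proof. by rewrite -scaleN1r; apply: spansetZ. Qed.

Lemma spansetB S w z : spanset S w -> spanset S z -> spanset S (w - z).
Proof. by move=> Sw /spansetN; apply: spansetD. Qed.

Lemma spanset_memv S (s : seq W) w :
  (forall z, z \in s -> spanset S z) -> w \in <<s>>%VS -> spanset S w.
Proof.
move=> sS; rewrite -[s]in_tupleE => /coord_span ->.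
elim/big_ind: _ => [|y z|i _]; [exact: spanset0|exact: spansetD|].
by apply/spansetZ/sS; rewrite mem_nth.
Qed.

Lemma spanset_min S T : (forall z, S z -> spanset T z) ->
  forall w, spanset S w -> spanset T w.
Proof. by move=> ST w [s [sS sw]]; apply: spanset_memv sw => z /sS/ST. Qed.

End SpanSet.

(** * Linear forms and common zeros *)

Section Duality.
Variables (K : fieldType) (V : vectType K).

Lemma mem_span_annihilator (s : seq 'Hom(V, K^o)) (f : 'Hom(V, K^o)) :
  (forall h, (forall g, g \in s -> g h = 0) -> f h = 0) -> f \in <<s>>%VS.
Proof.
elim: s f => [|g s IHs] f fs.
  suff -> : f = 0 by rewrite mem0v.
  by apply/lfunP => h; rewrite lfunE /=; apply: fs.
have [[h0 [sh0 gh0]]|no] := pselect (exists h0,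
  (forall g, g \in s -> g h0 = 0) /\ g h0 != 0); last first.
  rewrite span_cons; apply: subvP (addvSr _ _) _ _; apply: IHs => h sh.
  apply: fs => g'; rewrite inE => /orP[/eqP->|/sh//].
  by apply/eqP; apply: contra_notT no => gh; exists h.
rewrite span_cons -[f](subrK ((f h0 / g h0) *: g)) addrC.
apply: memv_add; first by rewrite memvZ ?memv_line.
apply: IHs => h sh; rewrite add_lfunE opp_lfunE scale_lfunE /=.
have : f (h - (g h / g h0) *: h0) = 0.
  apply: fs => g'; rewrite linearB linearZ /= inE => /orP[/eqP->|g's].
    by rewrite /GRing.scale /= divfK ?subrr.
  by rewrite (sh _ g's) (sh0 _ g's) scaler0 subrr.
rewrite linearB linearZ => <-; congr (_ - _); rewrite /GRing.scale /=.
by rewrite mulrAC [RHS]mulrAC [g h * _]mulrC.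
Qed.

End Duality.

(** * Effect of reflexions on Cartan matrices and spans *)

Section Reflexions.
Variables (K : fieldType) (X : finType) (V : vectType K).
Implicit Types (u v w : datum X V) (x y z : X).

Lemma Sp_Sk v u : Sp v u -> Sk v u.
Proof.
by elim=> [|{}u x _ vu ux _]; [exact: Sk_refl | exact: Sk_step].
Qed.

Lemma isotropic_reflectable u x : isotropic_at u x -> reflectable u x.
Proof. by constructor 1. Qed.

Lemma reflectable_isotropic u x :
  reflectable u x -> cartan u x x = 0 -> isotropic_at u x.
Proof. by move=> [//|[/eqP ? _ _]|[/eqP ? _ _]]. Qed.

Lemma Sp_iso v u x : Sp v u -> isotropic_at u x -> Sp v (iso_reflexion u x).
Proof.
move=> vu ux; have [uxx _] := ux.
by have := Sp_step vu (isotropic_reflectable ux) uxx; rewrite /reflexion uxx eqxx.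
Qed.

Lemma Sp_ind_iso v (P : datum X V -> Prop) : P v ->
  (forall u x, Sp v u -> P u -> isotropic_at u x -> P (iso_reflexion u x)) ->
  forall u, Sp v u -> P u.
Proof.
move=> Pv Pstep u; elim=> [//|{}u x vu Pu ux uxx].
rewrite /reflexion uxx eqxx; apply: Pstep => //.
exact: reflectable_isotropic.
Qed.

(** The [ra u y] are moved by a linear reflection of [V] and the [rb u z] by its transpose; the
    reflection is an involution. *)
Lemma cartan_aniso_reflexion u x : cartan u x x != 0 ->
  forall y z, cartan (aniso_reflexion u x) y z = cartan u y z.
Proof.
move=> uxx y z; rewrite /cartan /= !linearB !linearZ /=.
rewrite !(add_lfunE, opp_lfunE, scale_lfunE) /= -!/(cartan u _ _).
by rewrite /GRing.scale /=; field.
Qed.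

Lemma cartan_iso_reflexion u w x : cartan u =2 cartan w ->
  cartan (iso_reflexion u x) =2 cartan (iso_reflexion w x).
Proof.
move=> uw y z; rewrite /cartan /= -!/(cartan _ _ _) !uw.
have uwE a b : rb u b (ra u a) = rb w b (ra w a) := uw a b.
by do 4?case: ifP => _; rewrite ?(add_lfunE, opp_lfunE, linearD, linearN, linearZ)
  /= ?(add_lfunE, opp_lfunE) ?uwE.
Qed.

(** [rb u z] does not move, and [ra u y] moves only by a multiple of [ra u x], which [rb u z]
    kills. *)
Lemma cartan_iso_reflexion_fixed u x y z : z != x -> cartan u x z = 0 ->
  y != x -> cartan (iso_reflexion u x) y z = cartan u y z.
Proof.
move=> zx uxz yx; rewrite /cartan /= -!/(cartan _ _ _).
rewrite (negPf zx) (negPf yx) uxz eqxx; case: ifP => // _.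
by rewrite linearD linearZ /= -/(cartan u x z) uxz scaler0 addr0.
Qed.

Lemma path_iso_reflexion u x y (q : seq X) : y != x ->
  all (fun z => (z != x) && (cartan u x z == 0)) q ->
  path (fun y z => cartan u y z != 0) y q ->
  path (fun y z => cartan (iso_reflexion u x) y z != 0) y q.
Proof.
elim: q y => [//|z q IHq] y yx /= /andP[/andP[zx /eqP uxz] qx] /andP[uyz zq].
by rewrite cartan_iso_reflexion_fixed // uyz IHq.
Qed.

Lemma Sp_rb_span v u x : Sp v u -> spanset (range (rb v)) (rb u x).
Proof.
move=> vu; elim/Sp_ind_iso: vu x => [|{}u y _ IHu _] x /=.
  by apply: spanset_sub; exists x.
case: ifP => _; first exact: spansetN.
by case: ifP => _ //; apply: spansetD.
Qed.

(** The reflexion at [y] negates [rb u y] and adds 0 or [rb u y] to the others, so membership in the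
    span can be traced back along it. *)
Lemma Sp_rb_spanset v u (S : set 'Hom(V, K^o)) : Sp v u ->
  (forall x, spanset S (rb u x)) -> forall x, spanset S (rb v x).
Proof.
elim/Sp_ind_iso=> [//|{}u y _ IHu _] uS; apply: IHu => x.
have Sy : spanset S (rb u y).
  by have := uS y; rewrite /= eqxx => /spansetN; rewrite opprK.
have := uS x; rewrite /=; case: eqP => [-> //|_]; case: ifP => // _.
by move=> /spansetB /(_ Sy); rewrite addrK.
Qed.

End Reflexions.

(** * The span of the principal elements *)

Section Principal.
Variables (K : fieldType) (X : finType) (V : vectType K) (v : datum X V).
Hypothesis K2 : 2%:R != 0 :> K.
Local Notation S := (spanset (S_principal v)).
Implicit Types (u w : datum X V) (x y z : X).

Lemma principal_even u x : Sp v u -> rp u x = false -> S (rb u x).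
Proof. by move=> vu ux; apply: spanset_sub; exists u, x; split=> //; left. Qed.

Lemma principal_aniso u x : Sp v u -> cartan u x x != 0 -> S (rb u x).
Proof.
move=> vu uxx; have [ux|] := boolP (rp u x); last by move/negbTE/principal_even; apply.
rewrite -[rb u x]scale1r -(mulVf K2) -scalerA; apply/spansetZ/spanset_sub.
by exists u, x; split=> //; right.
Qed.

Lemma principal_or_isotropic u x :
  Sp v u -> ~ S (rb u x) -> isotropic_at u x.
Proof.
move=> vu nS; split.
  by apply/eqP; apply: contra_notT nS; apply: principal_aniso.
by apply: contra_notT nS => /negbTE; apply: principal_even.
Qed.

(* Anisotropic reflexions change the [b(y)] only by elements of the span of
   the principal roots, and leave the Cartan matrix and the parities alone. *)
Lemma Sk_mod_principal w : Sk v w -> exists u,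
  [/\ Sp v u, cartan w =2 cartan u, rp w =1 rp u
    & forall y, S (rb w y - rb u y)].
Proof.
elim=> [|{}w x _ [u [vu Awu pwu bwu]] wx].
  exists v; split=> // [|y]; first exact: Sp_refl.
  by rewrite subrr; apply: spanset0.
(* An isotropic reflexion of [w] is copied on [u]; an anisotropic one leaves [u] as it is. *)
rewrite /reflexion; case: (eqVneq (cartan w x x) 0) => [wxx|wxx].
  have [_ px] := reflectable_isotropic wx wxx.
  exists (iso_reflexion u x); split.
  - by apply: Sp_iso => //; split; [rewrite -Awu | rewrite -pwu].
  - exact: cartan_iso_reflexion.
  - by move=> y /=; rewrite Awu !pwu.
  - move=> y /=; rewrite Awu.
    case: ifP => _; first by rewrite -opprD; apply: spansetN.
    by case: ifP => _ //; rewrite opprD addrACA; apply: spansetD.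
exists u; split=> //.
  by move=> y z; rewrite cartan_aniso_reflexion.
move=> y /=; rewrite addrAC; apply: spansetB => //; apply: spansetZ.
rewrite -[rb w x](subrK (rb u x)); apply: spansetD => //.
by apply: principal_aniso => //; rewrite -Awu.
Qed.

(* If [b(y)] is not in the span, then the reflexion at [y] brings the isotropic
   end of a shortest path one step closer. *)
Lemma principal_path u y (q : seq X) : Sp v u ->
  path (fun y z => cartan u y z != 0) y q ->
  isotropic_at u (last y q) -> S (rb u (last y q)) -> S (rb u y).
Proof.
have [n] := ubnP (size q); elim: n u y q => // n IHn u y [//|z q] /= qn vu.
rewrite ltnS in qn.
move=> /andP[yz zq] xiso Sx; apply: contrapT => nSy.
have yiso := principal_or_isotropic vu nSy.
have Sz : S (rb u z) by apply: IHn zq xiso Sx.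
have zy : z != y by apply: contra_notN nSy => /eqP <-.
(* A return to [y] would allow a shorter path, and so would a later neighbour of [y]. *)
have [yq|yNq] := boolP (y \in q).
  case/splitPr: yq zq xiso Sx qn => q1 q2.
  rewrite cat_path last_cat /= size_cat => /and3P[_ _ yq2] xiso Sx qn.
  apply: nSy; apply: IHn yq2 xiso Sx => //.
  by apply: leq_trans qn; rewrite !ltnS; apply/ltnW/leq_addl.
have [/hasP[t tq yt]|/hasPn noq] := boolP (has (fun t => cartan u y t != 0) q).
  case/splitPr: tq zq xiso Sx qn => q1 q2.
  rewrite cat_path last_cat /= size_cat => /and3P[_ _ tq2] xiso Sx qn.
  apply: nSy; apply: (IHn u y (t :: q2)) => //=; last by rewrite yt.
  by apply: leq_trans qn; rewrite ltnS; apply: leq_addl.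
have qfix : all (fun t => (t != y) && (cartan u y t == 0)) q.
  apply/allP => t tq; rewrite -(negbK (_ == 0)) noq // andbT.
  by apply: contraNneq yNq => <-.
(* Since [rb u z] is in the span, it suffices to treat [rb u z + rb u y], the form at [z] after the
   reflexion. *)
apply: nSy; rewrite -[rb u y](addKr (rb u z)); apply: spansetD.
  exact: spansetN.
have -> : rb u z + rb u y = rb (iso_reflexion u y) z.
  by rewrite /= (negPf zy) (negPf yz).
have vu' := Sp_iso vu yiso.
(* If [z] is the isotropic end, it was odd and is now even; otherwise the induction hypothesis
   applies to the reflected datum. *)
case: q => [|t q] in qn zq xiso Sx yNq noq qfix *.
  by apply: principal_even => //=; rewrite (negPf zy) (negPf yz) xiso.2.
have /= zq' := path_iso_reflexion zy qfix zq.
have /(allP qfix)/andP[xy yx] : last t q \in t :: q by exact: mem_last.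
apply: (IHn (iso_reflexion u y) z (t :: q) _ vu' zq') => /=; first exact: qn.
  split; last by rewrite /= (negPf xy) yx xiso.2.
  by rewrite cartan_iso_reflexion_fixed ?(eqP yx) // xiso.1.
by rewrite (negPf xy) yx.
Qed.

Lemma principal_span : indecomposable v ->
  (S `&` Delta_iso v) !=set0 -> forall x, S (rb v x).
Proof.
move=> vind [f [Sx [w [x [vw wx wxx fE]]]]]; rewrite {f}fE in Sx.
have [u [vu Awu pwu bwu]] := Sk_mod_principal vw.
have [_ px] := reflectable_isotropic wx wxx.
have {}Sx : S (rb u x).
  by have := spansetB Sx (bwu x); rewrite opprB addrC subrK.
apply: (Sp_rb_spanset vu) => y.
have [[/eqP/card1P[t Xt] _]|conn] := vind u (Sp_Sk vu).
  have /eqP -> : y == x; last by [].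
  by have := Xt x; have := Xt y; rewrite !inE => /esym/eqP-> /esym/eqP->.
have /connectP[q yq xE] := conn y x.
by apply: (principal_path vu yq); rewrite -xE //; split; rewrite -?Awu -?pwu.
Qed.

End Principal.

(** * Weights lie in the span of the simple roots *)

Section Presentation.
Variables (K : fieldType) (X : finType) (V : vectType K) (v : datum X V).
Implicit Types (s t : term X V) (x y : X) (h : V).
Notation "s ~~~ t" := (eqv v s t) (at level 70).

Lemma eqv_0Z t : TScale 0 t ~~~ T0 X V.
Proof.
apply: eqv_trans _ (eqv_ND v t); rewrite -[0](addNr 1).
by apply: eqv_trans (eqv_ZDl _ _ _ _) _; apply/eqv_D/eqv_1Z/eqv_refl.
Qed.

Lemma eqv_Z0 c : TScale c (T0 X V) ~~~ T0 X V.
Proof.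
have e0 := eqv_sym (eqv_0Z (T0 X V)).
apply: eqv_trans (eqv_Z c e0) _; apply: eqv_trans (eqv_ZA _ _ _ _) _.
by rewrite mulr0; apply: eqv_0Z.
Qed.

Lemma eqv_Br0 s : TBr s (T0 X V) ~~~ T0 X V.
Proof.
have e0 := eqv_sym (eqv_0Z (T0 X V)).
apply: eqv_trans (eqv_Br (eqv_refl v s) e0) _.
by apply: eqv_trans (eqv_BrZr _ _ _ _) _; apply: eqv_0Z.
Qed.

Lemma eqv_0Br s : TBr (T0 X V) s ~~~ T0 X V.
Proof.
have e0 := eqv_sym (eqv_0Z (T0 X V)).
apply: eqv_trans (eqv_Br e0 (eqv_refl v s)) _.
by apply: eqv_trans (eqv_BrZl _ _ _ _) _; apply: eqv_0Z.
Qed.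

Lemma eqv_D0 s t : s ~~~ T0 X V -> t ~~~ T0 X V -> TAdd s t ~~~ T0 X V.
Proof. by move=> s0 t0; apply: eqv_trans (eqv_D s0 t0) _; apply: eqv_0D. Qed.

Lemma eqv_DACA s t r q :
  TAdd (TAdd s t) (TAdd r q) ~~~ TAdd (TAdd s r) (TAdd t q).
Proof.
apply: eqv_trans (eqv_sym (eqv_DA _ _ _ _)) _.
apply: eqv_trans _ (eqv_DA _ _ _ _); apply: eqv_D (eqv_refl _ _) _.
apply: eqv_trans (eqv_DA _ _ _ _) _.
apply: eqv_trans _ (eqv_sym (eqv_DA _ _ _ _)).
exact: eqv_D (eqv_DC _ _ _) (eqv_refl _ _).
Qed.

(** By the Jacobi rule, bracketing with the even element [h] is a derivation. *)
Lemma eqv_BrH0 h i s t : homog v i s ->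
  TBr (TH X h) s ~~~ T0 X V -> TBr (TH X h) t ~~~ T0 X V ->
  TBr (TH X h) (TBr s t) ~~~ T0 X V.
Proof.
move=> si hs ht; apply: eqv_trans (eqv_jacobi t (homogH v h) si) _.
apply: eqv_D0.
  by apply: eqv_trans (eqv_Br hs (eqv_refl v t)) _; apply: eqv_0Br.
apply: eqv_trans _ (eqv_Z0 _); apply: eqv_Z.
by apply: eqv_trans (eqv_Br (eqv_refl v s) ht) _; apply: eqv_Br0.
Qed.

Section Center.
Variables (h : V) (h0 : forall x, rb v x h = 0).

(* The Jacobi rule only applies to homogeneous terms, hence the splitting. *)
Lemma eqv_central_split t : exists t0 t1,
  [/\ t ~~~ TAdd t0 t1, homog v false t0 /\ TBr (TH X h) t0 ~~~ T0 X V
    & homog v true t1 /\ TBr (TH X h) t1 ~~~ T0 X V].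
Proof.
pose good i t := homog v i t /\ TBr (TH X h) t ~~~ T0 X V.
have good0 i : good i (T0 X V) by split; [exact: homog0|exact: eqv_Br0].
have goodD i t1 t2 : good i t1 -> good i t2 -> good i (TAdd t1 t2).
  move=> [t1i ht1] [t2i ht2]; split; first exact: homogD.
  by apply: eqv_trans (eqv_BrDr _ _ _ _) _; apply: eqv_D0.
have goodBr i j t1 t2 : good i t1 -> good j t2 -> good (i (+) j) (TBr t1 t2).
  move=> [t1i ht1] [t2i ht2]; split; first exact: homogBr.
  exact: eqv_BrH0 t1i ht1 ht2.
have good_split i t' : good i t' -> exists t0 t1,
    [/\ t' ~~~ TAdd t0 t1, good false t0 & good true t1].
  case: i => gt'.
    by exists (T0 X V), t'; split=> //; apply: eqv_sym (eqv_0D _ _).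
  exists t', (T0 X V); split=> //.
  exact: eqv_sym (eqv_trans (eqv_DC _ _ _) (eqv_0D _ _)).
have scale0 c t' : c = 0 -> TScale c t' ~~~ T0 X V.
  by move=> ->; apply: eqv_0Z.
change (exists t0 t1, [/\ t ~~~ TAdd t0 t1, good false t0 & good true t1]).
elim: t => [|s [s0 [s1 [sE gs0 gs1]]] t [t0 [t1 [tE gt0 gt1]]]
  |c t [t0 [t1 [tE [t0i ht0] [t1i ht1]]]]
  |s [s0 [s1 [sE gs0 gs1]]] t [t0 [t1 [tE gt0 gt1]]]|k|x|x].
- exact: (good_split false).
- exists (TAdd s0 t0), (TAdd s1 t1); split; try exact: goodD.
  by apply: eqv_trans (eqv_D sE tE) _; apply: eqv_DACA.
- exists (TScale c t0), (TScale c t1); split.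
  + by apply: eqv_trans (eqv_Z c tE) _; apply: eqv_ZDr.
  + split; first exact: homogZ.
    apply: eqv_trans (eqv_BrZr _ _ _ _) _.
    exact: eqv_trans (eqv_Z c ht0) (eqv_Z0 c).
  + split; first exact: homogZ.
    apply: eqv_trans (eqv_BrZr _ _ _ _) _.
    exact: eqv_trans (eqv_Z c ht1) (eqv_Z0 c).
- exists (TAdd (TBr s0 t0) (TBr s1 t1)), (TAdd (TBr s0 t1) (TBr s1 t0)).
  split.
  + apply: eqv_trans (eqv_Br sE tE) _; apply: eqv_trans (eqv_BrDl _ _ _ _) _.
    apply: eqv_trans (eqv_D (eqv_BrDr _ _ _ _) (eqv_BrDr _ _ _ _)) _.
    apply: eqv_trans (eqv_D (eqv_refl _ _) (eqv_DC _ _ _)) _.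
    exact: eqv_DACA.
  + by apply: goodD; [apply: (goodBr false false) | apply: (goodBr true true)].
  + by apply: goodD; [apply: (goodBr false true) | apply: (goodBr true false)].
- apply: (good_split false); split; [exact: homogH | exact: eqv_HH].
- apply: (good_split (rp v x)); split; first exact: homogE.
  by apply: eqv_trans (eqv_HE _ _ _) _; apply/scale0/h0.
- apply: (good_split (rp v x)); split; first exact: homogF.
  by apply: eqv_trans (eqv_HF _ _ _) _; apply/scale0; rewrite h0 oppr0.
Qed.

Lemma eqv_central t : TBr (TH X h) t ~~~ T0 X V.
Proof.
have [t0 [t1 [tE [_ ht0] [_ ht1]]]] := eqv_central_split t.
apply: eqv_trans (eqv_Br (eqv_refl _ _) tE) _.
by apply: eqv_trans (eqv_BrDr _ _ _ _) _; apply: eqv_D0.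
Qed.

End Center.

Lemma Delta_span (f : 'Hom(V, K^o)) : Delta v f -> spanset (range (rb v)) f.
Proof.
move=> [_ [t [nIt It]]].
apply: (@spanset_memv _ _ _ [seq rb v x | x <- enum X]).
  by move=> _ /mapP[x _ ->]; apply: spanset_sub; exists x.
apply: mem_span_annihilator => h hb; apply/eqP; apply: contra_notT nIt => fh.
have h0 x : rb v x h = 0 by apply: hb; rewrite map_f ?mem_enum.
(* As [h] is central, [I] contains [- f h] times [t]; a nonzero [f h] can be divided out. *)
have [I [idI IV Iht]] := It h; exists I; split=> //.
have [I0 ID IZ IBr Ieqv] := idI.
apply: Ieqv (IZ (- f h)^-1 _ (Ieqv _ _ _ Iht)).
  apply: eqv_trans (eqv_ZA _ _ _ _) _.
  by rewrite [_ * _](@mulVf K) ?oppr_eq0 //; apply: eqv_1Z.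
apply: eqv_trans (eqv_D (eqv_central h0 t) (eqv_refl _ _)) _.
exact: eqv_0D.
Qed.

End Presentation.

(** * A Verma module for the presented algebra *)

(* The presented algebra acts on the free associative algebra on the letters
   [F], with highest weight [lam], as on a Verma module:
     f_x w = x w,   h w = (lam(h) - sum of the b_y(h) over the letters y of w) w,
     e_x (y w) = delta_xy a(x) w + (-1)^(p(x) p(y)) y (e_x w),   e_x 1 = 0.
   [act t i] is the transpose, on functions of words, of the component of
   parity [i] of [t], so that products are composed in the reverse order. *)
Section Verma.
Variables (K : fieldType) (X : finType) (V : vectType K) (v : datum X V).
Variable lam : {scalar V}.
Implicit Types (s t r : term X V) (x y : X) (h : V) (w : seq X) (f g : seq X -> K^o).

Definition weight h w : K^o := \sum_(y <- w) rb v y h.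

Definition actH h f w : K^o := (lam h - weight h w) * f w.

Definition actF x f w : K^o := f (x :: w).

Fixpoint actE x f w : K^o :=
  if w is y :: w' then
    (if x == y then actH (ra v x) f w' else 0)
    + (-1) ^+ (rp v x && rp v y) * actE x (actF y f) w'
  else 0.

(** In the bracket clause, the even part of [s] meets the part of [t] of parity [i], the odd part
    that of parity [~~ i]; the sign is -1 only for two odd parts. *)
Fixpoint act t (i : bool) (f : seq X -> K^o) : seq X -> K^o :=
  match t with
  | T0 => 0
  | TAdd s t => act s i f + act t i f
  | TScale c t => c *: act t i f
  | TBr s t =>
      (act t i (act s false f) - act s false (act t i f))
      + (act t (~~ i) (act s true f)
         - ((-1) ^+ (~~ i) : K) *: act s true (act t (~~ i) f))
  | TH h => if i then 0 else actH h f
  | TE x => if i == rp v x then actE x f else 0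
  | TF x => if i == rp v x then actF x f else 0
  end.

Lemma actE_linear x c f g w :
  actE x (c *: f + g) w = c * actE x f w + actE x g w.
Proof.
elim: w f g => [|y w IHw] f g /=; first by rewrite mulr0 addr0.
rewrite -[actF y _]/(c *: actF y f + actF y g) IHw /actH.
rewrite -[(c *: f + g) w]/(c * f w + g w).
by case: ifP => _; ring.
Qed.

Lemma act_linear t i c f g : act t i (c *: f + g) = c *: act t i f + act t i g.
Proof.
elim: t i c f g => [|s IHs t IHt|d t IHt|s IHs t IHt|h|x|x] i c f g /=.
- by rewrite scaler0 addr0.
- by rewrite IHs IHt scalerDr addrACA.
- by rewrite IHt scalerDr !scalerA mulrC.
- rewrite !(IHs, IHt); apply/funext => w.
  by rewrite !fctE /=; rewrite /GRing.scale /=; ring.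
- case: i; first by rewrite scaler0 addr0.
  apply/funext => w; rewrite /actH !fctE /GRing.scale /=; ring.
- case: ifP => _; last by rewrite scaler0 addr0.
  by apply/funext => w; exact: actE_linear.
- by case: ifP => _ //; rewrite scaler0 addr0.
Qed.

Lemma act0r t i : act t i 0 = 0.
Proof. by have := act_linear t i (-1) 0 0; rewrite scaler0 addr0 scaleN1r addNr. Qed.

Lemma actDr t i f g : act t i (f + g) = act t i f + act t i g.
Proof. by have := act_linear t i 1 f g; rewrite !scale1r. Qed.

Lemma actZr t i c f : act t i (c *: f) = c *: act t i f.
Proof. by have := act_linear t i c f 0; rewrite act0r !addr0. Qed.

Lemma actNr t i f : act t i (- f) = - act t i f.
Proof. by rewrite -!scaleN1r actZr. Qed.

(** This reduces the sign rules for homogeneous terms to a finite check on parities. *)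
Lemma act_homog t i f : homog v i t -> act t (~~ i) f = 0.
Proof.
move=> ti; elim: ti f => {t i} [i|i s t _ IHs _ IHt|i c t _ IHt
  |i j s t _ IHs _ IHt|h|x|x] f //=.
- by rewrite IHs IHt addr0.
- by rewrite IHt scaler0.
- by case: i j IHs IHt => [] [] /= IHs IHt;
    rewrite !(IHs, IHt, act0r, scaler0, subr0, addr0).
- by case: (rp v x).
- by case: (rp v x).
Qed.

Lemma actH0 h : actH h 0 = 0.
Proof. exact: (act0r (TH X h) false). Qed.

Lemma actE0 x : actE x 0 = 0.
Proof. by have := act0r (TE V x) (rp v x); rewrite /= eqxx. Qed.

Lemma actF0 x : actF x 0 = 0.
Proof. by []. Qed.

Lemma weightD h k w : weight (h + k) w = weight h w + weight k w.
Proof. by rewrite -big_split; apply: eq_bigr => y _; rewrite linearD. Qed.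

Lemma weightZ c h w : weight (c *: h) w = c * weight h w.
Proof. by rewrite /weight big_distrr; apply: eq_bigr => y _; rewrite linearZ. Qed.

Lemma weight_cons h y w : weight h (y :: w) = rb v y h + weight h w.
Proof. exact: big_cons. Qed.

(** The constant [c] is arbitrary because stripping a letter [y] shifts it by [rb v y h]. *)
Lemma actE_weight c x h f w :
  actE x (fun w => (c - weight h w) * f w) w
    = (c + rb v x h - weight h w) * actE x f w.
Proof.
elim: w c f => [|y w IHw] c f /=; first by rewrite mulr0.
have -> : actF y (fun w => (c - weight h w) * f w)
    = (fun w => (c - rb v y h - weight h w) * actF y f w).
  by apply/funext => w'; rewrite /actF weight_cons; congr (_ * _); ring.
rewrite IHw /actH weight_cons; case: eqP => [->|_]; ring.
Qed.

Lemma act_HH h k i f : act (TBr (TH X h) (TH X k)) i f = 0.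
Proof.
case: i; rewrite /= ?(actH0, scaler0, oppr0, addr0) //.
apply/funext => w; by rewrite /actH !fctE /= -[0 w]/(0 : K); ring.
Qed.

Lemma act_EF x y i f :
  act (TBr (TE V x) (TF V y)) i f = act (if x == y then TH X (ra v x) else T0 X V) i f.
Proof.
(* This is the recursion defining [actE] on a word that starts with [y]. *)
have EF : actF y (actE x f) - (-1) ^+ (rp v x && rp v y) *: actE x (actF y f)
    = (if x == y then actH (ra v x) f else 0).
  by apply/funext => w; rewrite !fctE /actF /GRing.scale /= addrK; case: eqP.
have -> : act (if x == y then TH X (ra v x) else T0 X V) i f
  = if i then 0 else if x == y then actH (ra v x) f else 0.
  by case: eqP; case: i.
rewrite -EF /=; move: EF; case: eqP => [<- _|_].
  by case: (rp v x); case: i => /=;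
    rewrite ?(actF0, actE0, scaler0, oppr0, addr0, add0r, expr0, expr1,
      scale1r, scaleN1r).
by case: (rp v x); case: (rp v y); case: i => /=;
  rewrite ?(actF0, actE0, scaler0, oppr0, addr0, add0r, expr0, expr1,
    scale1r, scaleN1r) => // ->.
Qed.

Lemma act_HE h x i f :
  act (TBr (TH X h) (TE V x)) i f = rb v x h *: act (TE V x) i f.
Proof.
have HE : actE x (actH h f) - actH h (actE x f) = rb v x h *: actE x f.
  apply/funext => w; rewrite -[actH h f]/(fun w => (lam h - weight h w) * f w).
  by rewrite !fctE actE_weight /actH /GRing.scale /=; ring.
rewrite /=; case: (rp v x); case: i => /=;
  by rewrite ?(actH0, actE0, scaler0, oppr0, addr0, add0r).
Qed.

Lemma act_HF h x i f :
  act (TBr (TH X h) (TF V x)) i f = - rb v x h *: act (TF V x) i f.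
Proof.
have HF : actF x (actH h f) - actH h (actF x f) = - rb v x h *: actF x f.
  apply/funext => w; rewrite !fctE /actF /actH weight_cons /GRing.scale /=; ring.
rewrite /=; case: (rp v x); case: i => /=;
  by rewrite ?(actH0, actF0, scaler0, oppr0, addr0, add0r).
Qed.

Lemma act_eqv s t : eqv v s t -> forall i f, act s i f = act t i f.
Proof.
elim=> {s t} //=.
- by move=> s t r _ IH1 _ IH2 i f; rewrite IH1.
- by move=> s s' t t' _ IH1 _ IH2 i f; rewrite IH1 IH2.
- by move=> c t t' _ IH i f; rewrite IH.
- by move=> s s' t t' _ IH1 _ IH2 i f; rewrite !(IH1, IH2).
- by move=> r s t i f; rewrite addrA.
- by move=> s t i f; rewrite addrC.
- by move=> t i f; rewrite add0r.
- by move=> t i f; rewrite scaleN1r addNr.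
- by move=> c d t i f; rewrite scalerA.
- by move=> t i f; rewrite scale1r.
- by move=> c s t i f; rewrite scalerDr.
- by move=> c d t i f; rewrite scalerDl.
- move=> r s t i f; rewrite !(actDr, actNr, actZr).
  by apply/funext => w; rewrite !fctE /GRing.scale /=; ring.
- move=> r s t i f; rewrite !(actDr, actNr, actZr).
  by apply/funext => w; rewrite !fctE /GRing.scale /=; ring.
- move=> c s t i f; rewrite !(actDr, actNr, actZr).
  by apply/funext => w; rewrite !fctE /GRing.scale /=; ring.
- move=> c s t i f; rewrite !(actDr, actNr, actZr).
  by apply/funext => w; rewrite !fctE /GRing.scale /=; ring.
- move=> i j s t /act_homog sh /act_homog th k f; apply/funext => w.
  case: i j k sh th => [] [] [] /= sh th;
    rewrite !(sh, th, act0r, scaler0, oppr0, addr0, add0r);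
    by rewrite ?fctE /GRing.scale /=; ring.
- move=> i j r s t /act_homog rh /act_homog sh k f; apply/funext => w.
  case: i j k rh sh => [] [] [] /= rh sh;
    rewrite !(rh, sh, actDr, actNr, actZr, act0r, scaler0, oppr0, addr0, add0r);
    by rewrite ?fctE /GRing.scale /=; ring.
- move=> h k [] f; first by rewrite addr0.
  by apply/funext => w; rewrite /actH weightD linearD !fctE; ring.
- move=> c h [] f; first by rewrite scaler0.
  by apply/funext => w; rewrite /actH weightZ linearZ !fctE /GRing.scale /=; ring.
- by move=> h k i f; rewrite -[RHS](act_HH h k i f).
- exact: act_EF.
- exact: act_HE.
- exact: act_HF.
Qed.

End Verma.

(** * Simple roots are roots, and the conclusion *)

(** On the empty word [h] acts by the highest weight; letting this run over the coordinate forms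
    shows that all coordinates of [h] vanish. *)
Lemma eqv_TH0 (K : fieldType) (X : finType) (V : vectType K) (v : datum X V)
  (h : V) : eqv v (TH X h) (T0 X V) -> h = 0.
Proof.
move=> h0; rewrite (coord_vbasis (memvf h)); apply: big1 => i _.
have := act_eqv (coord (vbasis fullv) i) h0 false (fun=> 1).
move=> /(congr1 (fun f => f [::])) /=.
by rewrite /actH /weight big_nil subr0 mulr1 => ->; rewrite -[_ [::]]/0 scale0r.
Qed.

Lemma rb_Delta (K : fieldType) (X : finType) (V : vectType K) (v : datum X V) :
  root_datum v -> forall x, Delta v (rb v x).
Proof.
move=> [afree bfree] x.
have nz (W : vectType K) (c : X -> W) : free [seq c x | x <- enum X] -> c x != 0.
  move=> cfree; apply: contraTneq cfree => cx0; apply: contraTN isT => cfree.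
  by have := free_not0 cfree (map_f c (mem_enum X x)); rewrite cx0 eqxx.
split; first exact: nz.
exists (TE V x); split=> [[I [[_ _ _ IBr Ieqv] IV IE]]|h].
  have : I (TH X (ra v x)).
    apply: Ieqv (IBr (TF V x) _ IE).2.
    by have := eqv_EF v x x; rewrite eqxx.
  by move=> /IV/eqv_TH0/eqP; rewrite (negPf (nz _ _ afree)).
(* The zero ideal suffices: the weight equation of [TE V x] is a defining relation. *)
exists [set t | eqv v t (T0 X V)]; split=> //=.
- split=> /=.
  + exact: eqv_refl.
  + by move=> s t; apply: eqv_D0.
  + by move=> c t t0; apply: eqv_trans (eqv_Z c t0) (eqv_Z0 v c).
  + move=> s t t0; split.
      exact: eqv_trans (eqv_Br (eqv_refl v s) t0) (eqv_Br0 v s).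
    exact: eqv_trans (eqv_Br t0 (eqv_refl v s)) (eqv_0Br v s).
  + by move=> s t st; apply/eqv_trans/eqv_sym.
- apply: eqv_trans (eqv_D (eqv_HE v h x) (eqv_refl _ _)) _.
  apply: eqv_trans (eqv_DC _ _ _) _.
  apply: eqv_trans _ (eqv_ND v (TScale (rb v x h : K) (TE V x))).
  apply: eqv_D (eqv_refl _ _); apply: eqv_sym.
  by have := eqv_ZA v (-1) (rb v x h : K) (TE V x); rewrite mulN1r.
Qed.

Theorem proposition2p2p3 (R : realType) (X : finType) (V : vectType R[i])
    (v : datum X V) (hv : root_datum v)
    (hadm : admissible v) (hind : indecomposable v) :
  (spanset (S_principal v) `&` Delta_iso v) !=set0 ->
  spanset (Delta v) = spanset (S_principal v).
Proof.
move=> Siso; apply/seteqP; split; apply: spanset_min => f.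
  move=> /Delta_span; apply: spanset_min => _ [x _ <-].
  by apply: principal_span => //; rewrite Num.Theory.pnatr_eq0.
move=> [u [x [vu ux]]].
(* Isotropic reflexions keep [rb u x] in the span of the [rb v y], which are roots. *)
have Du : spanset (Delta v) (rb u x).
  apply: spanset_min (Sp_rb_span x vu) => _ [y _ <-].
  exact/spanset_sub/rb_Delta.
by case: ux => [[-> _]|[-> _ _]] //; apply: spansetZ.
Qed.
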